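(* For every positive integer $q$, the Coppersmith–Winograd tensor $CW_q$ satisfies $\omega_u(CW_q) \geq 2.16805$.
   Context: All tensors are over a field $\mathbb{F}$. A tensor over finite sets of formal variables $X,Y,Z$ is a trilinear form $T=\sum_{x\in X,y\in Y,z\in Z}\alpha_{xyz}\,xyz$ with $\alpha_{xyz}\in\mathbb{F}$. For tensors $T_1$ over $X_1,Y_1,Z_1$ and $T_2$ over $X_2,Y_2,Z_2$, the tensor product $T_1\otimes T_2$ is the tensor over $X_1\times X_2, Y_1\times Y_2, Z_1\times Z_2$ whose coefficient of $(x_1,x_2)(y_1,y_2)(z_1,z_2)$ is the product of the coefficient of $x_1y_1z_1$ in $T_1$ and of $x_2y_2z_2$ in $T_2$; $T^{\otimes n}$ is the $n$-fold tensor power. The direct sum $T_1\oplus T_2$ is the sum of the two tensors after making their variable sets disjoint. A tensor has rank one if it equals $(\sum_x a_x x)(\sum_y b_y y)(\sum_z c_z z)$; the rank $R(T)$ is the least number of rank-one tensors summing to $T$, and the asymptotic rank is $\tilde R(T)=\liminf_n R(T^{\otimes n})^{1/n}$. The matrix multiplication tensor $\langle a,b,c\rangle$ is $\sum_{i\in[a],j\in[b],k\in[c]}x_{ij}y_{jk}z_{ki}$. Degeneration: $T_2$ (over $X_2,Y_2,Z_2$) is a degeneration of $T_1$ (over $X_1,Y_1,Z_1$) if there are maps $\alpha:X_1\times X_2\to\mathbb{F}[\lambda]$, $\beta:Y_1\times Y_2\to\mathbb{F}[\lambda]$, $\gamma:Z_1\times Z_2\to\mathbb{F}[\lambda]$ and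 an integer $h$ such that, substituting $x\mapsto\sum_{x'}\alpha(x,x')x'$, $y\mapsto\sum_{y'}\beta(y,y')y'$, $z\mapsto\sum_{z'}\gamma(z,z')z'$ in $T_1$ and viewing the result as a polynomial in $\lambda$ with tensor coefficients over $X_2,Y_2,Z_2$, the coefficient of $\lambda^h$ is $T_2$ and the coefficients of $\lambda^{h'}$ for $h'<h$ are $0$. Universal Method: for a tensor $T$ with $R=\tilde R(T)$, for each positive integer $n$ and each degeneration of $T^{\otimes n}$ into a direct sum $\bigoplus_{i=1}^m\langle a_i,b_i,c_i\rangle$, the asymptotic sum inequality yields the upper bound on the matrix multiplication exponent given by the real $w$ with $\sum_{i=1}^m(a_ib_ic_i)^{w/3}=R^n$; $\omega_u(T)$ is the infimum (liminf) of these bounds over all $n$ and all such degenerations. $CW_q$ is the tensor over $\{x_0,\dots,x_{q+1}\},\{y_0,\dots,y_{q+1}\},\{z_0,\dots,z_{q+1}\}$ given by $x_0y_0z_{q+1}+x_0y_{q+1}z_0+x_{q+1}y_0z_0+\sum_{i=1}^q(x_iy_iz_0+x_iy_0z_i+x_0y_iz_i)$. *)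

(* Defs.v *)
From mathcomp Require Import all_boot all_order all_algebra.
From mathcomp Require Import all_classical all_reals all_analysis.

Set Implicit Arguments.
Unset Strict Implicit.
Unset Printing Implicit Defensive.

Import Order.TTheory GRing.Theory Num.Theory.

Local Open Scope ring_scope.

(* A trilinear form in the variables X, Y, Z is given by its coefficients. *)
Definition tensor (F : fieldType) (X Y Z : finType) := X -> Y -> Z -> F.

Definition monomial (F : fieldType) (X Y Z : finType) (x : X) (y : Y) (z : Z) :
    tensor F X Y Z :=
  fun x' y' z' => [&& x' == x, y' == y & z' == z]%:R.
Arguments monomial {F X Y Z} x y z.

(* The iterated product T (x) ... (x) T, with the iterated products of the
   variable sets presented as functions on 'I_n. *)
Definition tensor_pow (F : fieldType) (X Y Z : finType) (T : tensor F X Y Z)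
    (n : nat) :
    tensor F {ffun 'I_n -> X} {ffun 'I_n -> Y} {ffun 'I_n -> Z} :=
  fun x y z => \prod_(i < n) T (x i) (y i) (z i).
Arguments tensor_pow {F X Y Z} T n.

(* The variable sets are made disjoint by tagging; untag 0 i f u is f (tagged u)
   when u carries the tag i, and 0 otherwise. *)
Definition direct_sum (F : fieldType) (I : finType) (X Y Z : I -> finType)
    (T : forall i, tensor F (X i) (Y i) (Z i)) :
    tensor F {i : I & X i} {i : I & Y i} {i : I & Z i} :=
  fun u v w => \sum_(i : I)
    untag 0 (fun x => untag 0 (fun y => untag 0 (fun z => T i x y z) w) v) u.
Arguments direct_sum {F I X Y Z} T.

Definition rank_one (F : fieldType) (X Y Z : finType) (T : tensor F X Y Z) :
    Prop :=
  exists (a : X -> F) (b : Y -> F) (c : Z -> F),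
    forall x y z, T x y z = a x * b y * c z.

Definition sum_of_rank_ones (F : fieldType) (X Y Z : finType)
    (T : tensor F X Y Z) (r : nat) : Prop :=
  exists S : 'I_r -> tensor F X Y Z, (forall i, rank_one (S i)) /\
    forall x y z, T x y z = \sum_(i < r) S i x y z.

Lemma sum_of_rank_ones_ex (F : fieldType) (X Y Z : finType)
    (T : tensor F X Y Z) :
  exists r, `[< sum_of_rank_ones T r >].
Proof.
exists #|{: X * Y * Z}|; apply/asboolP.
exists (fun i x y z => let u : X * Y * Z := enum_val i in
  T u.1.1 u.1.2 u.2 * monomial u.1.1 u.1.2 u.2 x y z); split => [i|x y z].
  exists (fun x => let u : X * Y * Z := enum_val i in
           T u.1.1 u.1.2 u.2 * (x == u.1.1)%:R).
  exists (fun y => (y == (enum_val i : X * Y * Z).1.2)%:R).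
  exists (fun z => (z == (enum_val i : X * Y * Z).2)%:R).
  by move=> x y z /=; rewrite /monomial -!mulrA -!natrM !mulnb.
rewrite -(big_enum_val (fun u : X * Y * Z =>
  T u.1.1 u.1.2 u.2 * monomial u.1.1 u.1.2 u.2 x y z)) /=.
rewrite (bigD1 (x, y, z)) //= /monomial !eqxx mulr1 big1 ?addr0 //.
move=> [[x' y'] z'] /= ne; case: and3P; rewrite ?mulr0 //.
by case=> /eqP ex /eqP ey /eqP ez; rewrite ex ey ez eqxx in ne.
Qed.

Definition tensor_rank (F : fieldType) (X Y Z : finType)
    (T : tensor F X Y Z) : nat :=
  ex_minn (sum_of_rank_ones_ex T).

(* The sequence is bounded (by #|X| * #|Y| * #|Z|), so limn_inf is its genuine
   limit inferior; the index n = 0 is immaterial. *)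
Definition asymptotic_rank (R : realType) (F : fieldType) (X Y Z : finType)
    (T : tensor F X Y Z) : R :=
  limn_inf (fun n : nat => (tensor_rank (tensor_pow T n))%:R `^ n%:R^-1).

Definition substitution (F : fieldType) (X1 Y1 Z1 X2 Y2 Z2 : finType)
    (T : tensor F X1 Y1 Z1)
    (alpha : X1 -> X2 -> {poly F}) (beta : Y1 -> Y2 -> {poly F})
    (gamma : Z1 -> Z2 -> {poly F}) : X2 -> Y2 -> Z2 -> {poly F} :=
  fun x' y' z' => \sum_(x : X1) \sum_(y : Y1) \sum_(z : Z1)
    (T x y z)%:P * (alpha x x' * beta y y' * gamma z z').

Definition degeneration (F : fieldType) (X1 Y1 Z1 X2 Y2 Z2 : finType)
    (T1 : tensor F X1 Y1 Z1) (T2 : tensor F X2 Y2 Z2) : Prop :=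
  exists (alpha : X1 -> X2 -> {poly F}) (beta : Y1 -> Y2 -> {poly F})
         (gamma : Z1 -> Z2 -> {poly F}) (h : nat),
    forall x y z,
      (substitution T1 alpha beta gamma x y z)`_h = T2 x y z /\
      forall h', (h' < h)%N -> (substitution T1 alpha beta gamma x y z)`_h' = 0.

Definition matmul (F : fieldType) (a b c : nat) :
    tensor F ('I_a * 'I_b)%type ('I_b * 'I_c)%type ('I_c * 'I_a)%type :=
  fun x y z => \sum_(i < a) \sum_(j < b) \sum_(k < c)
    monomial (i, j) (j, k) (k, i) x y z.
Arguments matmul F a b c : clear implicits.

(* The dimensions are required to be positive: since 0 `^ 0 = 1, zero tensors
   would otherwise count as summands at w = 0. *)
Definition universal_bounds (R : realType) (F : fieldType) (X Y Z : finType)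
    (T : tensor F X Y Z) : set R :=
  [set w : R | exists (n m : nat) (a b c : 'I_m -> nat),
    [/\ (0 < n)%N,
        forall i, [/\ (0 < a i)%N, (0 < b i)%N & (0 < c i)%N],
        degeneration (tensor_pow T n)
          (direct_sum (fun i => matmul F (a i) (b i) (c i))) &
        \sum_(i < m) (a i * b i * c i)%N%:R `^ (w / 3) =
          asymptotic_rank R T ^+ n]]%classic.
Arguments universal_bounds R {F X Y Z} T.

(* Valued in the extended reals, so that the infimum is +oo when T yields no
   bound at all. *)
Definition omega_u (R : realType) (F : fieldType) (X Y Z : finType)
    (T : tensor F X Y Z) : \bar R :=
  ereal_inf [set w%:E | w in universal_bounds R T]%classic.
Arguments omega_u R {F X Y Z} T.

(* x_0 is ord0, x_(q+1) is ord_max, and x_i is inord i for 1 <= i <= q. *)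
Definition CW (F : fieldType) (q : nat) : tensor F 'I_q.+2 'I_q.+2 'I_q.+2 :=
  fun x y z =>
    monomial ord0 ord0 ord_max x y z + monomial ord0 ord_max ord0 x y z
    + monomial ord_max ord0 ord0 x y z
    + \sum_(1 <= i < q.+1)
        (monomial (inord i) (inord i) ord0 x y z
         + monomial (inord i) ord0 (inord i) x y z
         + monomial ord0 (inord i) (inord i) x y z).
Arguments CW F q : clear implicits.

(* Main.v *)
(* A weight on the variables of T1 is a grading of F^X1. A degeneration of T1
   to T2 turns it into a filtration of F^X2, and taking leading monomials for a
   total order on X2 gives weights on X2 whose generating function at
   0 < t < 1 is at most that of T1. If every monomial of T1 has weight at most
   D, so has every monomial of T2, provided the support of T2 is an antichain
   for the chosen orders, which is the case for direct sums of matrix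
   multiplication tensors. AM-GM on each summand then gives
     sum_l (a_l b_l c_l)^(2/3) * t^(D/3) <= G,
   where G bounds the three generating functions. For CW_q^(x)n with weights
   0, 1, 2 on x_0, x_i, x_(q+1) we have D = 2 n and G = (1 + q t + t^2)^n, so
   sum_l (a_l b_l c_l)^(2/3) <= s^n with s = (1 + q t + t^2) / t^(2/3). The
   asymptotic rank is at least q + 2 by flattening, and s^(w/2) < q + 2 for
   w = 2.16805 and a suitable t. The case q = 1, where s is nearly the cap set
   constant, is the tight one. *)

Require Import Defs.
From mathcomp Require Import all_boot all_order all_algebra.
From mathcomp Require Import all_classical all_reals all_analysis.
From mathcomp Require Import ring lra zify.

Set Implicit Arguments.
Unset Strict Implicit.
Unset Printing Implicit Defensive.

Import Order.TTheory GRing.Theory Num.Theory.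

Local Open Scope ring_scope.

(** * Leading monomials under degeneration *)

(** The transposed system, padded with zero columns to a square matrix, has determinant zero.
    Working over an integral domain keeps the solution in F[lambda]. *)
Lemma kernel_vector (D : idomainType) (I J : finType) (A : I -> J -> D) :
  (#|I| < #|J|)%N ->
  exists u : J -> D,
    (exists j, u j != 0) /\ forall i, \sum_j A i j * u j = 0.
Proof.
move=> ltIJ.
pose M : 'M[D]_#|J| := \matrix_(j, k)
  if insub (k : nat) is Some k' then A (enum_val (k' : 'I_#|I|)) (enum_val j)
  else 0.
have /det0P[v v0 vM] : \det M == 0.
  rewrite (expand_det_col _ (Ordinal ltIJ)) big1 // => j _.
  by rewrite mxE /= insubF ?mul0r // ltnn.
exists (fun j => v 0 (enum_rank j)); split.
  have /rV0Pn[j vj] := v0.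
  by exists (enum_val j); rewrite enum_valK.
move=> i; have ltk : (enum_rank i < #|J|)%N by exact: ltn_trans ltIJ.
have /matrixP/(_ 0 (Ordinal ltk)) := vM; rewrite !mxE => E; rewrite -[RHS]E.
rewrite (reindex (fun k : 'I_#|J| => enum_val k)) /=;
  last exact: onW_bij (@enum_val_bij _).
apply: eq_bigr => j _; rewrite mxE /= insubT //= => lti.
rewrite enum_valK mulrC; congr (_ * A _ _).
by rewrite -[LHS]enum_rankK; congr enum_val; apply: val_inj.
Qed.

Lemma kernel_vector_on (D : idomainType) (I J : finType) (A : I -> J -> D)
    (S : {set I}) (Q : {set J}) :
  (#|S| < #|Q|)%N ->
  exists u : J -> D, [/\ exists j, u j != 0,
    forall j, j \notin Q -> u j = 0
    & forall i, i \in S -> \sum_j A i j * u j = 0].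
Proof.
move=> ltSQ.
have [|u [[j uj] uS]] :=
  @kernel_vector D {i | i \in S} {j | j \in Q} (fun i j => A (val i) (val j)).
  by rewrite !card_sig.
exists (fun j => oapp u 0 (insub j)); split.
- by exists (val j); rewrite valK.
- by move=> k kQ; rewrite insubN.
move=> i iS; rewrite -[RHS](uS (Sub i iS)) (bigID (mem Q)) /= addrC big1.
  rewrite add0r big_sub; apply: eq_bigr => k _.
  by rewrite valK.
by move=> k kQ; rewrite insubN // mulr0.
Qed.

Section Pivots.
Variables (F : fieldType) (X1 X2 : finType).
Variables (rho : X2 -> nat) (A : X1 -> X2 -> {poly F}).

(** Pivots are the positions of leading monomials, for the order [rho], in the kernel over F[lambda]
    of the rows [S], specialised at lambda = 0. *)
Definition pivot (S : {set X1}) (x : X2) : Prop :=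
  exists u : X2 -> {poly F},
    [/\ forall s, s \in S -> \sum_y A s y * u y = 0,
        (u x)`_0 != 0
      & forall y, (rho y < rho x)%N -> (u y)`_0 = 0].

(* A kernel vector over F[lambda] supported on more than #|S| nonpivots would,
   once divided by the largest possible power of lambda, have a leading monomial
   among them. *)
Lemma card_nonpivot (S : {set X1}) :
  (#|[set x | ~~ `[< pivot S x >]]| <= #|S|)%N.
Proof.
rewrite leqNgt; apply/negP; set Q := [set x | _] => ltSQ.
have [u [[j uj] uQ uS]] := kernel_vector_on A ltSQ.
have exk : exists k, [exists y, (u y)`_k != 0].
  by exists (size (u j)).-1; apply/existsP; exists j; rewrite lead_coef_eq0.
case: (ex_minnP exk) => k /existsP[y yk] kmin.
pose u' y := drop_poly k (u y).
have uE y' : u y' = u' y' * 'X^k.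
  rewrite -[LHS](poly_take_drop k) [X in X + _](_ : _ = 0) ?add0r //.
  apply/polyP => i; rewrite coef_take_poly coef0; case: ltnP => // ik.
  apply/eqP/negPn/negP => nz.
  have := kmin i; rewrite leqNgt ik => /(_ _)/negP; apply=> //.
  by apply/existsP; exists y'.
have u'0 y' : (u' y')`_0 = (u y')`_k by rewrite coef_drop_poly add0n.
pose P y := (u' y)`_0 != 0.
have Py : P y by rewrite /P u'0.
case: (arg_minnP rho Py) => x Px xmin.
have xQ : x \in Q.
  by apply/negPn/negP => /uQ u0; move: Px; rewrite /P u'0 u0 coef0 eqxx.
move: xQ; rewrite inE => /asboolP; apply; exists u'; split => //.
  move=> s /uS; under eq_bigr do rewrite uE mulrA.
  by rewrite -mulr_suml => /eqP; rewrite mulf_eq0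
    (negbTE (monic_neq0 (monicXn _ k))) orbF => /eqP.
move=> y' lty; apply/eqP/negPn/negP => /xmin.
by rewrite leqNgt lty.
Qed.

(* d' x is the largest e such that x is a leading monomial of the kernel of the
   rows of weight less than e, truncated at N. *)
Lemma transfer_weight (d : X1 -> nat) (N : nat) :
  exists d' : X2 -> nat,
    [/\ forall x, (d' x <= N)%N,
        forall x, pivot [set y | (d y < d' x)%N] x
      & forall e, (e < N)%N ->
          (#|[set x | (d' x <= e)%N]| <= #|[set x | (d x <= e)%N]|)%N].
Proof.
pose S e := [set y | (d y < e)%N].
pose P x := [pred e : 'I_N.+1 | `[< pivot (S e) x >]].
exists (fun x => \max_(e in P x) e); split.
- by move=> x; apply/bigmax_leqP => e _; rewrite -ltnS.
(* No row has weight below 0, so every position is a pivot for e = 0 and the maximum runs over a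
   nonempty set. *)
- move=> x; have P0 : (0 < #|P x|)%N.
    apply/card_gt0P; exists ord0; rewrite inE /=; apply/asboolP.
    have := card_nonpivot (S 0); rewrite (_ : S 0 = finset.set0).
      rewrite cards0 leqn0 cards_eq0 => /eqP/setP/(_ x).
      by rewrite !inE => /negbFE/asboolP.
    by apply/setP => y; rewrite !inE ltn0.
  by case: (eq_bigmax_cond (fun e : 'I_N.+1 => e : nat) P0) => e /asboolP pe ->.
(* By maximality of [d' x], a position with [d' x <= e] is not a pivot for the rows of weight at
   most [e]; [e < N] keeps [e.+1] in range. *)
- move=> e eN; apply: leq_trans (card_nonpivot (S e.+1)).
  apply/subset_leq_card/fintype.subsetP => x; rewrite !inE => le_e.
  apply/negP => pe.
  suff : (e.+1 <= e)%N by rewrite ltnn.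
  apply: leq_trans le_e.
  rewrite -[X in (X <= _)%N](@inordK N) ?ltnS //.
  apply: (@leq_bigmax_cond _ (P x) (fun e : 'I_N.+1 => e : nat)).
  by rewrite inE inordK ?ltnS //; apply/asboolP.
Qed.

End Pivots.

(** Summation by parts: [f (d x)] telescopes from [d x] up to [M]. Only sizes of sublevel sets
    remain, which is what [transfer_weight] controls. *)
Lemma sum_layer (R : realDomainType) (X : finType) (d : X -> nat) (f : nat -> R)
    (M : nat) :
  (forall x, (d x <= M)%N) ->
  \sum_x f (d x) = \sum_(0 <= e < M)
     (f e - f e.+1) * #|[set x | (d x <= e)%N]|%:R + f M * #|X|%:R.
Proof.
move=> dM.
have E x : f (d x) =
    \sum_(0 <= e < M) (if (d x <= e)%N then f e - f e.+1 else 0) + f M.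
  rewrite -big_mkcond /= -[X in X + _]opprK -sumrN.
  under eq_bigr do rewrite opprB.
  rewrite (big_cat_nat (n := d x)) //= big_nat_cond big_pred0 ?add0r; last first.
    by move=> e; apply/negbTE/negP; lia.
  rewrite big_nat_cond (eq_bigl (fun e => (d x <= e < M)%N && true)); last first.
    by move=> e; lia.
  by rewrite -big_nat_cond telescope_sumr // opprB subrK.
rewrite (eq_bigr _ (fun x _ => E x)) big_split /= exchange_big /=.
congr (_ + _); last by rewrite sumr_const mulr_natr cardT -cardE.
apply: eq_bigr => e _; rewrite -big_mkcond /= sumr_const mulr_natr.
by rewrite cardsE.
Qed.

(** In the layered form the coefficients [f e - f e.+1] and [f M] are nonnegative, so the two sums
    compare layer by layer. *)
Lemma sum_weight_le (R : realDomainType) (X1 X2 : finType)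
    (d1 : X1 -> nat) (d2 : X2 -> nat) (f : nat -> R) :
  (forall e, 0 <= f e) -> (forall e, f e.+1 <= f e) ->
  (forall e, (#|[set x | (d2 x <= e)%N]| <= #|[set x | (d1 x <= e)%N]|)%N) ->
  \sum_x f (d2 x) <= \sum_x f (d1 x).
Proof.
move=> f0 fS cnt.
pose M := (\max_x d1 x + \max_x d2 x)%N.
have M1 x : (d1 x <= M)%N by rewrite (leq_trans (leq_bigmax x)) ?leq_addr.
have M2 x : (d2 x <= M)%N by rewrite (leq_trans (leq_bigmax x)) ?leq_addl.
rewrite (sum_layer f M1) (sum_layer f M2) lerD //.
  by apply: ler_sum => e _; rewrite ler_wpM2l ?subr_ge0 // ler_nat.
rewrite ler_wpM2l // ler_nat; have := cnt M.
by rewrite !cardsE !(eq_card (B := predT)) // => x; rewrite inE /in_mem /= ?M1 ?M2.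
Qed.

Section Leading.
Variables (F : fieldType) (X1 Y1 Z1 X2 Y2 Z2 : finType).
Variables (T1 : tensor F X1 Y1 Z1) (T2 : tensor F X2 Y2 Z2).
Variables (alpha : X1 -> X2 -> {poly F}) (beta : Y1 -> Y2 -> {poly F}).
Variables (gamma : Z1 -> Z2 -> {poly F}).

(** By trilinearity, contracting the substituted form with three vectors evaluates [T1] at their
    images, which makes kernel conditions applicable. *)
Lemma substitution_contract (u : X2 -> {poly F}) (v : Y2 -> {poly F})
    (w : Z2 -> {poly F}) :
  \sum_x' \sum_y' \sum_z' substitution T1 alpha beta gamma x' y' z'
      * (u x' * v y' * w z') =
  \sum_x \sum_y \sum_z (T1 x y z)%:P *
    ((\sum_x' alpha x x' * u x') * (\sum_y' beta y y' * v y')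
     * (\sum_z' gamma z z' * w z')).
Proof.
rewrite /substitution !pair_bigA /=.
under eq_bigr do rewrite !pair_bigA /= mulr_suml.
under [RHS]eq_bigr => p _.
  rewrite big_distrlr /= pair_bigA /= big_distrlr /= pair_bigA /= mulr_sumr.
  over.
rewrite exchange_big /=; apply: eq_bigr => [[[x y] z] _] /=.
apply: eq_bigr => [[[x' y'] z'] _] /=.
by ring.
Qed.

(* The coefficient of lambda^h of the form at the three kernel vectors is
   T2 x y z times a unit, as the antichain hypothesis kills all other terms. *)
Lemma degeneration_pivot (h : nat) (rX : X2 -> nat) (rY : Y2 -> nat)
    (rZ : Z2 -> nat) (S1 : {set X1}) (S2 : {set Y1}) (S3 : {set Z1})
    (x : X2) (y : Y2) (z : Z2) :
  (forall x y z, (substitution T1 alpha beta gamma x y z)`_h = T2 x y z /\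
    forall h', (h' < h)%N ->
      (substitution T1 alpha beta gamma x y z)`_h' = 0) ->
  T2 x y z != 0 ->
  (forall x' y' z', T2 x' y' z' != 0 -> (rX x <= rX x')%N ->
     (rY y <= rY y')%N -> (rZ z <= rZ z')%N -> (x', y', z') = (x, y, z)) ->
  pivot rX alpha S1 x -> pivot rY beta S2 y -> pivot rZ gamma S3 z ->
  exists x1 y1 z1, [/\ T1 x1 y1 z1 != 0, x1 \notin S1, y1 \notin S2
    & z1 \notin S3].
Proof.
move=> deg Txyz anti [u [uS u0 ul]] [v [vS v0 vl]] [w [wS w0 wl]].
apply: contrapT => none.
(* Were every monomial of [T1] to have a variable in [S1], [S2] or [S3], each would vanish on the
   images of the kernel vectors. *)
have sub0 : \sum_x' \sum_y' \sum_z' substitution T1 alpha beta gamma x' y' z'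
      * (u x' * v y' * w z') = 0.
  rewrite substitution_contract big1 // => x1 _; rewrite big1 // => y1 _.
  rewrite big1 // => z1 _.
  case: (boolP (T1 x1 y1 z1 == 0)) => [/eqP->|nz]; first by rewrite mul0r.
  case: (boolP (x1 \in S1)) => [/uS->|n1]; first by rewrite !mul0r mulr0.
  case: (boolP (y1 \in S2)) => [/vS->|n2]; first by rewrite mulr0 mul0r mulr0.
  case: (boolP (z1 \in S3)) => [/wS->|n3]; first by rewrite !mulr0.
  by case: none; exists x1, y1, z1.
(* After division by lambda^h, setting lambda = 0 extracts exactly [T2]. *)
pose Q x' y' z' := drop_poly h (substitution T1 alpha beta gamma x' y' z').
have QE x' y' z' : substitution T1 alpha beta gamma x' y' z' = 'X^h * Q x' y' z'.
  rewrite -[LHS](poly_take_drop h) [X in X + _](_ : _ = 0) ?add0r 1?mulrC //.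
  apply/polyP => i; rewrite coef_take_poly coef0; case: ltnP => // ih.
  by have [_ ->] := deg x' y' z'.
have Q0 x' y' z' : (Q x' y' z').[0] = T2 x' y' z'.
  by rewrite horner_coef0 coef_drop_poly; have [<- _] := deg x' y' z'.
move: sub0; under eq_bigr do under eq_bigr do under eq_bigr do
  rewrite QE -mulrA.
under eq_bigr do under eq_bigr do rewrite -mulr_sumr.
under eq_bigr do rewrite -mulr_sumr.
rewrite -mulr_sumr => /eqP; rewrite mulf_eq0
  (negbTE (monic_neq0 (monicXn _ h))) /= => /eqP.
move=> /(congr1 (fun p => p.[0])); rewrite horner0 horner_sum.
under eq_bigr do rewrite horner_sum.
under eq_bigr do under eq_bigr do rewrite horner_sum.
under eq_bigr do under eq_bigr do under eq_bigr do
  rewrite !hornerM Q0 !horner_coef0.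
have Z x' y' z' : (x', y', z') != (x, y, z) ->
    T2 x' y' z' * ((u x')`_0 * (v y')`_0 * (w z')`_0) = 0.
  move=> ne; case: (boolP (T2 x' y' z' == 0)) => [/eqP->|nz].
    by rewrite mul0r.
  case: (ltnP (rX x') (rX x)) => [/ul->|h1]; first by rewrite !mul0r mulr0.
  case: (ltnP (rY y') (rY y)) => [/vl->|h2]; first by rewrite mulr0 mul0r mulr0.
  case: (ltnP (rZ z') (rZ z)) => [/wl->|h3]; first by rewrite !mulr0.
  by rewrite anti ?eqxx in ne.
rewrite !pair_bigA /= (bigD1 (x, y, z)) //= big1 ?addr0; last first.
  by case=> [[x' y'] z'] /= /Z.
by apply/eqP; rewrite !mulf_neq0.
Qed.

End Leading.

(** * Matrix multiplication tensors *)

Lemma direct_sum_support (F : fieldType) (I : finType) (X Y Z : I -> finType)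
    (T : forall i, tensor F (X i) (Y i) (Z i))
    (u : {i : I & X i}) (v : {i : I & Y i}) (w : {i : I & Z i}) :
  direct_sum T u v w != 0 ->
  exists i x y z, [/\ u = Tagged X x, v = Tagged Y y, w = Tagged Z z
                    & T i x y z != 0].
Proof.
move=> nz; have [i _ nzi] : exists2 i, true &
    untag 0 (fun x => untag 0 (fun y => untag 0 (fun z => T i x y z) w) v) u != 0.
  apply: contrapT => none; move/eqP: nz; apply; apply: big1 => i _.
  by apply/eqP/negPn/negP => nzi; apply: none; exists i.
exists i; case: u v w nzi {nz} => [i1 x] [i2 y] [i3 z].
have [e1|ne] := eqVneq i1 i; last by rewrite untag_dflt ?eqxx.
have [e2|ne] := eqVneq i2 i; last first.
  by rewrite untagE /= [untag 0 _ (existT _ i2 y)]untag_dflt ?eqxx.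
have [e3|ne] := eqVneq i3 i; last first.
  subst i1 i2; rewrite (untagE _ _ (erefl i : tag (Tagged X x) = i)).
  by rewrite (untagE _ _ (erefl i : tag (Tagged Y y) = i)) untag_dflt ?eqxx.
subst i1 i2 i3; rewrite (untagE _ _ (erefl i : tag (Tagged X x) = i)).
rewrite (untagE _ _ (erefl i : tag (Tagged Y y) = i)).
rewrite (untagE _ _ (erefl i : tag (Tagged Z z) = i)) => nz.
by exists x, y, z.
Qed.

Lemma direct_sum_Tagged (F : fieldType) (I : finType) (X Y Z : I -> finType)
    (T : forall i, tensor F (X i) (Y i) (Z i)) (i : I)
    (x : X i) (y : Y i) (z : Z i) :
  direct_sum T (Tagged X x) (Tagged Y y) (Tagged Z z) = T i x y z.
Proof.
rewrite /direct_sum (bigD1 i) //= big1 ?addr0; last first.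
  by move=> j ne; rewrite untag_dflt //= eq_sym.
rewrite (untagE _ _ (erefl i : tag (Tagged X x) = i)).
rewrite (untagE _ _ (erefl i : tag (Tagged Y y) = i)).
by rewrite (untagE _ _ (erefl i : tag (Tagged Z z) = i)).
Qed.

Lemma matmul_support (F : fieldType) (a b c : nat) x y z :
  matmul F a b c x y z != 0 ->
  exists i j k, [/\ x = (i, j), y = (j, k) & z = (k, i)].
Proof.
move=> nz; apply: contrapT => none; move/eqP: nz; apply.
rewrite /matmul big1 // => i _; rewrite big1 // => j _; rewrite big1 // => k _.
rewrite /monomial; case: and3P => // -[/eqP xE /eqP yE /eqP zE].
by case: none; exists i, j, k.
Qed.

Lemma matmul_one (F : fieldType) (a b c : nat)
    (i : 'I_a) (j : 'I_b) (k : 'I_c) :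
  matmul F a b c (i, j) (j, k) (k, i) = 1.
Proof.
rewrite /matmul (bigD1 i) //= (bigD1 j) //= (bigD1 k) //=.
rewrite {1}/monomial !eqxx /= !big1 ?addr0 //.
- move=> i' ne; rewrite big1 // => j' _; rewrite big1 // => k' _.
  by rewrite /monomial !xpair_eqE (eq_sym i) (negbTE ne).
- move=> j' ne; rewrite big1 // => k' _.
  by rewrite /monomial !xpair_eqE (eq_sym j) (negbTE ne) andbF.
- move=> k' ne.
  by rewrite /monomial !xpair_eqE (eq_sym k) (negbTE ne) !andbF.
Qed.

Lemma lex_leq (K p p' r r' : nat) : (r < K)%N -> (r' < K)%N ->
  (p * K + r <= p' * K + r')%N -> (p <= p')%N /\ (p = p' -> (r <= r')%N).
Proof. by move=> rK r'K le; split; [nia | move=> e; subst; lia]. Qed.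

(** The index [l] enters the third rank with the opposite sign, whence l = l'. The middle digits
    then give k' <= k <= k' and j' <= j, the last digit of the second rank gives j <= j', and the
    last digits of the other two pinch [i]. *)
Lemma lex_antichain (K m l l' i j k i' j' k' : nat) :
  (l < m)%N -> (l' < m)%N -> (i < K)%N -> (j < K)%N -> (k < K)%N ->
  (i' < K)%N -> (j' < K)%N -> (k' < K)%N ->
  ((l * K + (K - j.+1)) * K + i <= (l' * K + (K - j'.+1)) * K + i')%N ->
  ((l * K + (K - k.+1)) * K + j <= (l' * K + (K - k'.+1)) * K + j')%N ->
  (((m - l.+1) * K + k) * K + (K - i.+1) <=
     ((m - l'.+1) * K + k') * K + (K - i'.+1))%N ->
  [/\ l = l', i = i', j = j' & k = k'].
Proof.
move=> lm lm' iK jK kK iK' jK' kK'.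
have subK p : (p < K -> K - p.+1 < K)%N by move=> ?; lia.
move=> /(lex_leq iK iK')[/(lex_leq (subK _ jK) (subK _ jK'))[xl xj] xi].
move=> /(lex_leq jK jK')[/(lex_leq (subK _ kK) (subK _ kK'))[yl yk] yj].
move=> /(lex_leq (subK _ iK) (subK _ iK'))[/(lex_leq kK kK')[zl zk] zi].
have el : l = l' by clear -lm lm' xl zl; lia.
subst l'.
have {xl yl zl xj yk zk} [xj yk zk] := And3 (xj erefl) (yk erefl) (zk erefl).
have ek : k = k' by clear -kK kK' yk zk; lia.
subst k'; have {}yj := yj erefl.
have ej : j = j' by clear -jK jK' yj xj; lia.
subst j'; have {}xi := xi erefl; have {}zi := zi erefl.
by split=> //; clear -iK iK' xi zi; lia.
Qed.

Section MatmulOrders.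
Variables (m : nat) (a b c : 'I_m -> nat) (K : nat).

(* Lexicographic orders on (l, -j, i), (l, -k, j) and (-l, k, -i) for the
   variables x_ij, y_jk, z_ki of the l-th summand. *)
Definition rhoX (u : {l : 'I_m & ('I_(a l) * 'I_(b l))%type}) : nat :=
  (tag u * K + (K - (tagged u).2.+1)) * K + (tagged u).1.
Definition rhoY (u : {l : 'I_m & ('I_(b l) * 'I_(c l))%type}) : nat :=
  (tag u * K + (K - (tagged u).2.+1)) * K + (tagged u).1.
Definition rhoZ (u : {l : 'I_m & ('I_(c l) * 'I_(a l))%type}) : nat :=
  ((m - (tag u).+1) * K + (tagged u).1) * K + (K - (tagged u).2.+1).

Lemma rho_antichain (F : fieldType) :
  (forall l, [/\ (a l <= K)%N, (b l <= K)%N & (c l <= K)%N]) ->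
  let T := direct_sum (fun l => matmul F (a l) (b l) (c l)) in
  forall x y z x' y' z', T x y z != 0 -> T x' y' z' != 0 ->
  (rhoX x <= rhoX x')%N -> (rhoY y <= rhoY y')%N -> (rhoZ z <= rhoZ z')%N ->
  (x', y', z') = (x, y, z).
Proof.
move=> leK T x y z x' y' z'.
move=> /direct_sum_support[l [? [? [? [-> -> ->]]]]].
move=> /matmul_support[i [j [k [-> -> ->]]]].
move=> /direct_sum_support[l' [? [? [? [-> -> ->]]]]].
move=> /matmul_support[i' [j' [k' [-> -> ->]]]].
rewrite /rhoX /rhoY /rhoZ /=.
have [ha hb hc] := leK l; have [ha' hb' hc'] := leK l'.
move=> hx hy hz.
have [el ei ej ek] := lex_antichain (ltn_ord l) (ltn_ord l')
  (leq_trans (ltn_ord i) ha) (leq_trans (ltn_ord j) hb)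
  (leq_trans (ltn_ord k) hc) (leq_trans (ltn_ord i') ha')
  (leq_trans (ltn_ord j') hb') (leq_trans (ltn_ord k') hc') hx hy hz.
move/ord_inj: el => el; subst l'.
by rewrite (ord_inj ei) (ord_inj ej) (ord_inj ek).
Qed.
End MatmulOrders.

(* AM-GM: each exponential is bounded below by its tangent at the point where
   the three sums agree. *)
Lemma block_bound (R : realType) (a b c D : nat) (t : R)
    (d1 : 'I_a * 'I_b -> nat) (d2 : 'I_b * 'I_c -> nat)
    (d3 : 'I_c * 'I_a -> nat) :
  (0 < a)%N -> (0 < b)%N -> (0 < c)%N -> 0 < t < 1 ->
  (forall i j k, (d1 (i, j) + d2 (j, k) + d3 (k, i) <= D)%N) ->
  3 * ((a * b * c)%N%:R `^ (2 / 3) * t `^ (D%:R / 3)) <=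
  \sum_x t ^+ d1 x + \sum_y t ^+ d2 y + \sum_z t ^+ d3 z.
Proof.
move=> a0 b0 c0 /andP[t0 t1] dD.
have pos n : (0 < n)%N -> 0 < n%:R :> R by rewrite ltr0n.
pose la : R := ln a%:R; pose lb : R := ln b%:R; pose lc : R := ln c%:R.
pose L := ln t; have L0 : L < 0 by rewrite ln_lt0 // t0.
pose lv := 2 / 3 * (la + lb + lc) + D%:R / 3 * L.
pose V := expR lv.
have VE : (a * b * c)%N%:R `^ (2 / 3) * t `^ (D%:R / 3) = V.
  rewrite /powR gt_eqF ?pos ?muln_gt0 ?a0 ?b0 // gt_eqF // -expRD /V /lv.
  by rewrite !natrM !lnM ?posrE ?mulr_gt0 ?pos.
rewrite VE.
(* [V] is the common value of the three sums in the equality case; spread evenly over the [n1 * n2]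
   variables it gives the exponent [y0] where the tangent is taken. *)
have tangent (I : finType) (d : I -> nat) (n1 n2 : nat) :
    (0 < n1)%N -> (0 < n2)%N -> #|I| = (n1 * n2)%N ->
    V * (1 - lv + ln n1%:R + ln n2%:R
         + L * ((\sum_i d i)%N%:R / (n1 * n2)%N%:R)) <=
      \sum_i t ^+ d i.
  move=> n10 n20 cI; pose y0 := lv - ln n1%:R - ln n2%:R.
  have nn0 : (n1 * n2)%N%:R != 0 :> R by rewrite gt_eqF ?pos ?muln_gt0 ?n10.
  have y0E : expR y0 * (n1 * n2)%N%:R = V.
    have -> : (n1 * n2)%N%:R = expR (ln n1%:R + ln n2%:R) :> R.
      by rewrite expRD !lnK ?posrE ?pos // natrM.
    by rewrite -expRD /V; congr expR; rewrite /y0; ring.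
  apply: (@le_trans _ _ (\sum_i expR y0 * (1 + (d i)%:R * L - y0))).
    rewrite -mulr_sumr !big_split /= sumr_const cI sumr_const cI -mulr_suml.
    rewrite -natr_sum -y0E /y0; set s := (\sum_i d i)%N.
    rewrite -[(- _) *+ _]mulr_natr.
    rewrite le_eqVlt; apply/orP; left; apply/eqP.
    rewrite -mulrA; congr (_ * _); move: nn0.
    by move: (_ %:R) => P P0; field.
  apply: ler_sum => i _.
  have -> : t ^+ d i = expR y0 * expR ((d i)%:R * L - y0).
    rewrite -expRD addrC subrK mulrC -[in LHS](@lnK _ t) ?posrE //.
    by rewrite -expRM_natr.
  by rewrite ler_wpM2l ?expR_ge0 // -addrA expR_ge1Dx.
(* The average of each weight is also its average over all triples (i, j, k), on which the three
   weights add up to at most [D]. *)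
have avg : (\sum_x d1 x)%N%:R / (a * b)%N%:R + (\sum_x d2 x)%N%:R / (b * c)%N%:R
    + (\sum_x d3 x)%N%:R / (c * a)%N%:R <= D%:R :> R.
  have : (c * (\sum_x d1 x) + a * (\sum_x d2 x) + b * (\sum_x d3 x)
      <= a * b * c * D)%N.
    have e1 : (c * (\sum_x d1 x) =
        \sum_(i < a) \sum_(j < b) \sum_(k < c) d1 (i, j))%N.
      rewrite pair_bigA /= big_distrr; apply: eq_bigr => -[i j] _ /=.
      by rewrite big_const_ord iter_addn_0 mulnC.
    have e2 : (a * (\sum_x d2 x) =
        \sum_(i < a) \sum_(j < b) \sum_(k < c) d2 (j, k))%N.
      rewrite big_const_ord iter_addn_0 mulnC; congr muln; rewrite pair_bigA /=.
      by apply: eq_bigr => -[].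
    have e3 : (b * (\sum_x d3 x) =
        \sum_(i < a) \sum_(j < b) \sum_(k < c) d3 (k, i))%N.
      rewrite exchange_big /= big_const_ord iter_addn_0 mulnC exchange_big /=.
      rewrite pair_bigA /=; congr muln.
      by apply: eq_bigr => -[].
    rewrite e1 e2 e3 -!big_split /=.
    apply: (@leq_trans (\sum_(i < a) \sum_(j < b) \sum_(k < c) D)%N).
      apply: leq_sum => i _; rewrite -!big_split; apply: leq_sum => j _.
      by rewrite -!big_split; apply: leq_sum => k _; exact: dD.
    by rewrite !big_const_ord !iter_addn_0; lia.
  rewrite -(ler_nat R) !natrD !natrM.
  set s1 := (\sum_x d1 x)%N; set s2 := (\sum_x d2 x)%N.
  set s3 := (\sum_x d3 x)%N.
  have := pos a a0; have := pos b b0; have := pos c c0.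
  move=> c0' b0' a0' le.
  have -> : s1%:R / (a%:R * b%:R) + s2%:R / (b%:R * c%:R)
       + s3%:R / (c%:R * a%:R)
     = (c%:R * s1%:R + a%:R * s2%:R + b%:R * s3%:R) / (a%:R * b%:R * c%:R) :> R.
    move: (a%:R : R) (b%:R : R) (c%:R : R)
      (s1%:R : R) (s2%:R : R) (s3%:R : R) a0' b0' c0'.
    move=> x y z p1 p2 p3 x0 y0 z0; field.
    by apply/and3P; split; apply: lt0r_neq0.
  by rewrite ler_pdivrMr ?mulr_gt0 // [leRHS]mulrC.
have h1 := tangent _ d1 a b a0 b0; have h2 := tangent _ d2 b c b0 c0.
have h3 := tangent _ d3 c a c0 a0.
rewrite !card_prod !card_ord in h1 h2 h3.
apply: le_trans (lerD (lerD (h1 erefl) (h2 erefl)) (h3 erefl)).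
rewrite -!mulrDr mulrC ler_wpM2l ?expR_ge0 //.
move: avg; set A1 := _ / _; set A2 := _ / _; set A3 := _ / _ => avg.
have : L * D%:R <= L * (A1 + A2 + A3) by rewrite ler_wnM2l // ltW.
rewrite /lv -/la -/lb -/lc.
set y := L * (_ + _) => yL.
(* Each of [la], [lb], [lc] comes from two of the three sums, so the coefficient 2/3 in [lv] makes
   the logarithms cancel. *)
have -> : (1 - (2 / 3 * (la + lb + lc) + D%:R / 3 * L) + la + lb + L * A1 +
  (1 - (2 / 3 * (la + lb + lc) + D%:R / 3 * L) + lb + lc + L * A2) +
  (1 - (2 / 3 * (la + lb + lc) + D%:R / 3 * L) + lc + la + L * A3)) =
  3 - L * D%:R + y by rewrite /y; field.
lra.
Qed.

Lemma sum_tagged (R : nmodType) (I : finType) (X : I -> finType)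
    (f : {i : I & X i} -> R) :
  \sum_u f u = \sum_i \sum_(x : X i) f (Tagged X x).
Proof.
rewrite (@sig_big_dep R 0 +%R I X xpredT (fun _ => xpredT)
  (fun i x => f (Tagged X x))).
by apply: eq_bigr => -[].
Qed.

Lemma matmul_degeneration_bound (R : realType) (F : fieldType)
    (X1 Y1 Z1 : finType) (T1 : tensor F X1 Y1 Z1) (dX : X1 -> nat)
    (dY : Y1 -> nat) (dZ : Z1 -> nat) (D : nat) (m : nat) (a b c : 'I_m -> nat)
    (t : R) :
  (forall x y z, T1 x y z != 0 -> (dX x + dY y + dZ z <= D)%N) ->
  (forall l, [/\ (0 < a l)%N, (0 < b l)%N & (0 < c l)%N]) ->
  degeneration T1 (direct_sum (fun l => matmul F (a l) (b l) (c l))) ->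
  0 < t < 1 ->
  3 * (\sum_l (a l * b l * c l)%N%:R `^ (2 / 3) * t `^ (D%:R / 3)) <=
  \sum_x t ^+ dX x + \sum_y t ^+ dY y + \sum_z t ^+ dZ z.
Proof.
move=> wD pos [alpha [beta [gamma [h deg]]]] t01.
have /andP[t0 t1] := t01.
set T2 := direct_sum _ in deg.
pose K := (\max_l (a l + b l + c l))%N.
have leK l : [/\ (a l <= K)%N, (b l <= K)%N & (c l <= K)%N].
  have le : (a l + b l + c l <= K)%N by exact: (leq_bigmax l).
  by split; apply: leq_trans le; lia.
have [d1 [d1N d1P d1C]] := transfer_weight (@rhoX m a b K) alpha dX D.+1.
have [d2 [d2N d2P d2C]] := transfer_weight (@rhoY m b c K) beta dY D.+1.
have [d3 [d3N d3P d3C]] := transfer_weight (@rhoZ m a c K) gamma dZ D.+1.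
have dD x y z : T2 x y z != 0 -> (d1 x + d2 y + d3 z <= D)%N.
  move=> nz.
  have [|x1 [y1 [z1 [/wD le]]]] :=
    degeneration_pivot deg nz _ (d1P x) (d2P y) (d3P z).
    by move=> x' y' z' nz'; exact: (rho_antichain leK nz nz').
  by rewrite !inE -!leqNgt; lia.
have dT l (i : 'I_(a l)) (j : 'I_(b l)) (k : 'I_(c l)) :
    (d1 (Tagged (fun l => 'I_(a l) * 'I_(b l))%type (i, j))
     + d2 (Tagged (fun l => 'I_(b l) * 'I_(c l))%type (j, k))
     + d3 (Tagged (fun l => 'I_(c l) * 'I_(a l))%type (k, i)) <= D)%N.
  by apply: dD; rewrite /T2 direct_sum_Tagged matmul_one oner_eq0.
(* The dimensions being positive, every variable occurs in a monomial of [T2], so the truncation at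
   [D.+1] is never reached. *)
have bnd : [/\ forall x, (d1 x <= D)%N, forall y, (d2 y <= D)%N
    & forall z, (d3 z <= D)%N].
  split; move=> [l [i j]]; have [al bl cl] := pos l.
  - by apply: leq_trans (dT l i j (Ordinal cl)); rewrite -addnA leq_addr.
  - by apply: leq_trans (dT l (Ordinal al) i j); rewrite addnAC leq_addl.
  - by apply: leq_trans (dT l j (Ordinal bl) i); rewrite leq_addl.
have cnt (X X' : finType) (d : X -> nat) (d' : X' -> nat) :
    (forall x, (d' x <= D)%N) ->
    (forall e, (e < D.+1)%N ->
      (#|[set x | (d' x <= e)%N]| <= #|[set x | (d x <= e)%N]|)%N) ->
    \sum_x t ^+ d' x <= \sum_x t ^+ d x.
  move=> le C; apply: (sum_weight_le (f := fun e => t ^+ e)) => e.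
  - by rewrite exprn_ge0 // ltW.
  - by rewrite exprS ler_piMl ?exprn_ge0 // ltW.
  (* Above level [D] the left sublevel set is already all of [X'], so the comparison at level [D]
     suffices. *)
  have [eD|De] := leqP e D; first exact: C.
  apply: leq_trans (subset_leq_card _) _; last first.
    apply: leq_trans (C D (ltnSn D)) (subset_leq_card _).
    by apply/fintype.subsetP => x; rewrite !inE => /leq_trans->//; exact: ltnW.
  by apply/fintype.subsetP => x _; rewrite inE le.
have [b1 b2 b3] := bnd.
apply: le_trans (lerD (lerD (cnt _ _ _ _ b1 d1C) (cnt _ _ _ _ b2 d2C))
  (cnt _ _ _ _ b3 d3C)).
rewrite !sum_tagged -!big_split mulr_sumr; apply: ler_sum => l _ /=.
by have [al bl cl] := pos l; apply: block_bound => //; exact: dT.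
Qed.

(** * The Coppersmith-Winograd tensor *)

(** The limit inferior is the supremum of the tail infima, and the tail from 1 on already has
    infimum at least [l]. Index 0 is left out because the exponent [n%:R^-1] is 0 there. *)
Lemma limn_inf_ge (R : realType) (u : nat -> R) (l M : R) :
  (forall n, (0 < n)%N -> l <= u n) -> (forall n, 0 <= u n <= M) ->
  l <= limn_inf u.
Proof.
move=> lu uM.
have bu : bounded_fun u.
  exists M; split; first exact: num_real.
  move=> x Mx n _ /=; have /andP[u0 uM'] := uM n.
  by rewrite ger0_norm // (le_trans uM') // ltW.
rewrite limn_infE //.
have hs : has_sup (range (infs u)).
  split; first by exists (infs u 0); exists 0%N.
  exact/bounded_fun_has_ubound_infs.
apply: (@le_trans _ _ (infs u 1%N)).
  apply: lb_le_inf; first by exists (u 1%N); exists 1%N => //=.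
  by move=> _ [n /= n1 <-]; apply: lu.
by apply: sup_upper_bound => //; exists 1%N.
Qed.

Lemma tensor_rankP (F : fieldType) (X Y Z : finType) (T : tensor F X Y Z) :
  sum_of_rank_ones T (tensor_rank T).
Proof. by rewrite /tensor_rank; case: ex_minnP => r /asboolP. Qed.

Lemma tensor_rank_le (F : fieldType) (X Y Z : finType) (T : tensor F X Y Z) :
  (tensor_rank T <= #|X| * #|Y| * #|Z|)%N.
Proof.
rewrite /tensor_rank; case: ex_minnP => r _; rewrite -!card_prod; apply.
apply/asboolP.
exists (fun i x y z => let u : X * Y * Z := enum_val i in
  T u.1.1 u.1.2 u.2 * monomial u.1.1 u.1.2 u.2 x y z); split => [i|x y z].
  set u : X * Y * Z := enum_val i.
  exists (fun x => T u.1.1 u.1.2 u.2 * (x == u.1.1)%:R), (fun y => (y == u.1.2)%:R),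
    (fun z => (z == u.2)%:R) => x y z /=.
  by rewrite /monomial -!mulrA -!natrM !mulnb.
rewrite -(big_enum_val (fun u : X * Y * Z =>
  T u.1.1 u.1.2 u.2 * monomial u.1.1 u.1.2 u.2 x y z)) /=.
rewrite (bigD1 (x, y, z)) //= /monomial !eqxx mulr1 big1 ?addr0 //.
move=> [[x' y'] z'] /= ne; case: and3P; rewrite ?mulr0 //.
by case=> /eqP ex /eqP ey /eqP ez; rewrite ex ey ez eqxx in ne.
Qed.

(** Restricted to the pairs ([y x'], [z x']), the flattening of [T] is an identity matrix, and a
    decomposition into r rank-one tensors factors it through dimension r. *)
Lemma flattening_rank (F : fieldType) (X Y Z : finType) (T : tensor F X Y Z)
    (y : X -> Y) (z : X -> Z) :
  (forall x x', T x (y x') (z x') = (x == x')%:R) -> (#|X| <= tensor_rank T)%N.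
Proof.
move=> dual; have [S [S1 TS]] := tensor_rankP T.
have /choice[abc abcE] : forall i, exists p : (X -> F) * (Y -> F) * (Z -> F),
    forall x y z, S i x y z = p.1.1 x * p.1.2 y * p.2 z.
  by move=> i; have [a [b [c E]]] := S1 i; exists (a, b, c).
pose A : 'M[F]_(#|X|, tensor_rank T) := \matrix_(k, i) (abc i).1.1 (enum_val k).
pose B : 'M[F]_(tensor_rank T, #|X|) :=
  \matrix_(i, k) ((abc i).1.2 (y (enum_val k)) * (abc i).2 (z (enum_val k))).
have AB : A *m B = 1%:M.
  apply/matrixP => k l; rewrite !mxE.
  rewrite -(inj_eq enum_val_inj) -dual TS; apply: eq_bigr => i _.
  by rewrite !mxE abcE mulrA.
by rewrite -[leqLHS](@mxrank1 F) -AB (leq_trans (mxrankM_maxr _ _)) ?rank_leq_row.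
Qed.

Section CoppersmithWinograd.
Variables (F : fieldType) (q : nat).

Definition cw_weight (x : 'I_q.+2) : nat :=
  if x == ord0 then 0 else if x == ord_max then 2 else 1.

Lemma cw_weight_inord i : (1 <= i < q.+1)%N -> cw_weight (inord i) = 1%N.
Proof.
move=> hi; rewrite /cw_weight -!val_eqE /= inordK; last by lia.
by rewrite !ifF //; apply/negbTE; lia.
Qed.

Lemma CW_support x y z : CW F q x y z != 0 ->
  (cw_weight x + cw_weight y + cw_weight z = 2)%N.
Proof.
have wm : cw_weight ord_max = 2%N by rewrite /cw_weight ?eqxx.
have w0 : cw_weight ord0 = 0%N by rewrite /cw_weight ?eqxx.
have mono x0 y0 z0 : (cw_weight x0 + cw_weight y0 + cw_weight z0 = 2)%N ->
    (cw_weight x + cw_weight y + cw_weight z != 2)%N ->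
    monomial x0 y0 z0 x y z = 0 :> F.
  move=> e2 ne2; rewrite /monomial; case: and3P => // -[/eqP xE /eqP yE /eqP zE].
  by rewrite xE yE zE e2 in ne2.
move=> nz; apply/eqP; apply: contraNT nz => ne2; rewrite /CW !mono ?wm ?w0 //.
rewrite !add0r big_nat_cond big1 // => i /andP[hi _].
by rewrite !mono ?cw_weight_inord ?w0 // !addr0.
Qed.

(** Each chosen pair of y and z variables lies in exactly one monomial of CW_q, namely x_0 y_0
    z_(q+1), x_(q+1) y_0 z_0 or x_i y_i z_0. *)
Definition cw_dualY (x : 'I_q.+2) : 'I_q.+2 :=
  if x == ord_max then ord0 else x.
Definition cw_dualZ (x : 'I_q.+2) : 'I_q.+2 :=
  if x == ord0 then ord_max else ord0.

Lemma CW_dual x x' : CW F q x (cw_dualY x') (cw_dualZ x') = (x == x')%:R.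
Proof.
rewrite /CW /monomial /cw_dualY /cw_dualZ.
have m0 : (ord_max == ord0 :> 'I_q.+2) = false by [].
have i0 i : (1 <= i < q.+1)%N -> (inord i == ord0 :> 'I_q.+2) = false.
  by move=> hi; rewrite -val_eqE /= inordK; lia.
have im i : (1 <= i < q.+1)%N -> (inord i == ord_max :> 'I_q.+2) = false.
  by move=> hi; rewrite -val_eqE /= inordK; lia.
have [->|x'0] := eqVneq x' ord0.
  rewrite !(eq_sym ord0 ord_max) m0 !eqxx !andbF !andbT /= !addr0.
  rewrite big_nat_cond big1 ?addr0 // => i /andP[hi _].
  rewrite ![ord_max == inord _]eq_sym ![ord0 == inord _]eq_sym im // i0 //.
  by rewrite !andbF !addr0.
have [->|x'm] := eqVneq x' ord_max.
  rewrite !(eq_sym ord0 ord_max) m0 !eqxx ?andbF ?andbT /= ?add0r.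
  rewrite big_nat_cond big1 ?addr0 // => i /andP[hi _].
  by rewrite ![ord0 == inord _]eq_sym i0 // !andbF !addr0.
rewrite !(eq_sym ord0 ord_max) m0 (negbTE x'0) (negbTE x'm) !eqxx ?andbF ?andbT /= ?add0r.
have hx' : (1 <= x' < q.+1)%N.
  move: x'0 x'm; rewrite -!val_eqE /=; have := ltn_ord x'; lia.
rewrite big_nat_cond (eq_bigr (fun i => if i == x' :> nat then (x == x')%:R else 0)).
  rewrite -big_nat_cond -big_mkcond /= big_nat1_eq.
  by rewrite hx'.
move=> i /andP[hi _]; rewrite [ord0 == inord _]eq_sym i0 // !andbF !addr0.
case: (eqVneq i (x' : nat)) => [->|ne]; first by rewrite inord_val !eqxx !andbT.
rewrite (_ : (x' == inord i) = false) ?andbF // -val_eqE /= inordK; last by lia.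
by apply/negbTE; rewrite eq_sym.
Qed.

Lemma CW_pow_rank_ge n : (q.+2 ^ n <= tensor_rank (tensor_pow (CW F q) n))%N.
Proof.
rewrite -[X in (X ^ _)%N]card_ord -[X in (_ ^ X)%N]card_ord -card_ffun.
apply: (@flattening_rank _ _ _ _ _
  (fun x : {ffun 'I_n -> 'I_q.+2} => [ffun i => cw_dualY (x i)])
  (fun x : {ffun 'I_n -> 'I_q.+2} => [ffun i => cw_dualZ (x i)])) => x x'.
rewrite /tensor_pow; under eq_bigr do rewrite !ffunE CW_dual.
have [->|ne] := eqVneq x x'; first by rewrite big1 // => i _; rewrite eqxx.
have [i nei] : exists i, x i != x' i.
  apply/existsP; apply: contraNT ne; rewrite negb_exists => /forallP h.
  by apply/eqP/ffunP => i; apply/eqP/negPn/h.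
by rewrite (bigD1 i) //= (negbTE nei) mul0r.
Qed.

Lemma asymptotic_rank_CW_ge (R : realType) :
  q.+2%:R <= asymptotic_rank R (CW F q).
Proof.
apply: (@limn_inf_ge _ _ _ ((q.+2 ^ 3)%N%:R)) => n.
  move=> n0; rewrite -[leLHS](@powRr1 R) ?ler0n //.
  have nn : n%:R != 0 :> R by rewrite pnatr_eq0 -lt0n.
  rewrite -[X in _ `^ X <= _](@mulfV _ n%:R) // powRrM.
  rewrite ge0_ler_powR ?nnegrE ?powR_ge0 //.
  by rewrite powR_mulrn // -natrX ler_nat CW_pow_rank_ge.
(* The term at n = 0 is 1, since the inverse of 0 is 0; for the others the trivial rank bound
   (q+2)^(3n) is enough. *)
rewrite powR_ge0 /=; case: n => [|n].
  by rewrite invr0 powRr0 ler1n expn_gt0.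
rewrite -[leRHS](@powRr1 R) ?ler0n //.
rewrite -[X in _ <= _ `^ X](@mulfV _ n.+1%:R) ?pnatr_eq0 // powRrM.
rewrite ge0_ler_powR ?nnegrE ?invr_ge0 ?powR_ge0 //.
rewrite powR_mulrn // -natrX ler_nat (leq_trans (tensor_rank_le _)) //.
by rewrite !card_ffun !card_ord -!expnMn !expnS expn0 muln1 mulnA.
Qed.

Lemma CW_pow_support n x y z : tensor_pow (CW F q) n x y z != 0 ->
  (\sum_i cw_weight (x i) + \sum_i cw_weight (y i) + \sum_i cw_weight (z i)
    = 2 * n)%N.
Proof.
move=> /prodf_neq0 nz; rewrite -!big_split /= (eq_bigr (fun=> 2%N)).
  by rewrite big_const_ord iter_addn_0.
by move=> i _; apply: CW_support; apply: nz.
Qed.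

Lemma cw_weight_gen (R : comNzRingType) (t : R) n :
  \sum_(x : {ffun 'I_n -> 'I_q.+2}) t ^+ (\sum_i cw_weight (x i)) =
  (1 + q%:R * t + t ^+ 2) ^+ n.
Proof.
under eq_bigr do rewrite expr_sum.
rewrite -(bigA_distr_bigA (fun _ k => t ^+ cw_weight k)) /= prodr_const card_ord.
congr (_ ^+ n); rewrite big_ord_recl big_ord_recr /= /cw_weight eqxx /= expr0.
rewrite addrA; congr (_ + _ + _); last by rewrite ifT // -val_eqE.
rewrite (eq_bigr (fun=> t)); first by rewrite sumr_const card_ord mulr_natl.
move=> i _; rewrite ifF //; apply/negbTE.
by rewrite -val_eqE /= /bump /=; have := ltn_ord i; lia.
Qed.

End CoppersmithWinograd.

(** * Numerical bounds *)

(** Factor y^p as y * y^(p-1) and bound each y^(p-1) by the power of the full sum. This passes from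
    the exponent 2/3 to [omega0 R / 3]. *)
Lemma powR_superadd (R : realType) (I : finType) (x : I -> R) (p : R) :
  1 <= p -> (forall i, 0 <= x i) ->
  \sum_i x i `^ p <= (\sum_i x i) `^ p.
Proof.
move=> p1 x0; set S := \sum_i x i.
have S0 : 0 <= S by apply: sumr_ge0.
have E (y : R) : 0 <= y -> y `^ p = y * y `^ (p - 1).
  move=> y0; have [->|yn] := eqVneq y 0.
    by rewrite mul0r powR0 // gt_eqF // (lt_le_trans ltr01).
  by rewrite -{2}(powRr1 y0) -powRD ?yn ?implybT // addrC subrK.
rewrite (E _ S0) {1}/S mulr_suml; apply: ler_sum => i _; rewrite E //.
rewrite ler_wpM2l // ge0_ler_powR ?nnegrE ?subr_ge0 //.
by rewrite /S (bigD1 i) //= lerDl sumr_ge0.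
Qed.

(** With s = G * t^(-2/3) the last hypothesis says s^(3N) <= u^(3M), the factor 3 clearing the
    denominator in the exponent; M/N < 2/w then gives the strict bound. *)
Lemma rate_lt_of_exprn (R : realType) (G t u w : R) (N M : nat) :
  0 < G -> 0 < t -> 1 < u -> (0 < N)%N -> 0 < w -> M%:R * w < 2 * N%:R ->
  G ^+ (3 * N) <= t ^+ (2 * N) * u ^+ (3 * M) ->
  (G * t `^ (- (2 / 3))) `^ (w / 2) < u.
Proof.
move=> G0 t0 u1 N0 w0 MN le.
have u0 : 0 < u by exact: lt_trans u1.
have lu : 0 < ln u by rewrite ln_gt0.
have N0' : 0 < N%:R :> R by rewrite ltr0n.
have : (3 * N)%:R * ln G <= (2 * N)%:R * ln t + (3 * M)%:R * ln u.
  rewrite !mulr_natl -!lnXn // -lnM ?posrE ?exprn_gt0 //.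
  by rewrite ler_ln ?posrE ?mulr_gt0 ?exprn_gt0.
rewrite !natrM => lel.
have s0 : 0 < G * t `^ (- (2 / 3)) by rewrite mulr_gt0 ?powR_gt0.
rewrite /powR gt_eqF // -[ltRHS](lnK (x := u)) ?posrE // ltr_expR.
rewrite lnM ?posrE ?powR_gt0 // ln_powR.
set s := ln G + _.
have sN : N%:R * s <= M%:R * ln u by rewrite /s; lra.
rewrite -(ltr_pM2l N0').
apply: (@le_lt_trans _ _ (w / 2 * (M%:R * ln u))).
  by rewrite mulrCA ler_wpM2l // divr_ge0 // ltW.
rewrite (_ : _ * _ = (M%:R * w) / 2 * ln u); last by ring.
by rewrite ltr_pM2r // ltr_pdivrMr // [ltRHS]mulrC.
Qed.

(** Chaining the [e]-th power of the first comparison with the second leaves only the common factor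
    Q^e to cancel. *)
Lemma exprn_le_of_steps (R : realType) (r K P Q : R) (n m i j e : nat) :
  0 <= r -> 0 <= K -> 0 <= P -> 0 < Q ->
  Q * r ^+ n <= P * K ^+ m -> P ^+ e * r ^+ i <= Q ^+ e * K ^+ j ->
  r ^+ (n * e + i) <= K ^+ (m * e + j).
Proof.
move=> r0 K0 P0 Q0 le1 le2.
rewrite -(ler_pM2l (exprn_gt0 e Q0)) exprD exprM mulrA -exprMn.
apply: (@le_trans _ _ ((P * K ^+ m) ^+ e * r ^+ i)).
  rewrite ler_wpM2r ?exprn_ge0 // lerXn2r // nnegrE mulr_ge0 ?exprn_ge0 //.
  exact: ltW.
rewrite exprMn mulrAC exprD exprM [leRHS]mulrCA [leLHS]mulrC.
by rewrite ler_wpM2l ?exprn_ge0.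
Qed.

(* (12 * 90 + 3) / (13 * 90 + 4) lies between log_3 s and 2 / 2.16805. As 12 / 13
   is slightly too large, r^13 < 27^12 holds with the factor 508 / 521 to spare;
   ninety such factors absorb the excess of r^4 over 27^3. *)
Lemma cap_set_certificate (R : realType) (r : R) :
  0 <= r -> r * (3 ^+ 12 * 2 ^+ 8) = 1417 ^+ 3 ->
  r ^+ (13 * 90 + 4) <= 27 ^+ (12 * 90 + 3).
Proof.
move=> r0 rE; have b0 : 0 < 3 ^+ 12 * 2 ^+ 8 :> R by lra.
have r13 : 521 * r ^+ 13 <= 508 * 27 ^+ 12.
  rewrite -(ler_pM2r (exprn_gt0 13 b0)) -mulrA -exprMn rE; lra.
have r4 : 508 ^+ 90 * r ^+ 4 <= 521 ^+ 90 * 27 ^+ 3.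
  rewrite -(ler_pM2r (exprn_gt0 4 b0)) -mulrA -exprMn rE; lra.
by apply: exprn_le_of_steps r13 r4; rewrite ?ler0n ?ltr0n.
Qed.

Lemma cw1_rate_exprn (R : realType) :
  (1 + 1%:R * (16 / 27) + (16 / 27) ^+ 2 : R) ^+ (3 * (13 * 90 + 4)) <=
  (16 / 27) ^+ (2 * (13 * 90 + 4)) * 3%:R ^+ (3 * (12 * 90 + 3)).
Proof.
have -> : 1 + 1%:R * (16 / 27) + (16 / 27) ^+ 2 = 1417 / 729 :> R by field.
rewrite !exprM.
(* [r] is s^3 at t = 16/27, so the claim becomes a comparison of powers of [r] and 27. *)
pose r : R := 1417 ^+ 3 / (3 ^+ 12 * 2 ^+ 8).
have -> : (1417 / 729) ^+ 3 = (16 / 27) ^+ 2 * r by rewrite /r; field.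
have rE : r * (3 ^+ 12 * 2 ^+ 8) = 1417 ^+ 3 by rewrite /r; field.
have r0 : 0 <= r by rewrite /r; lra.
have -> : 3 ^+ 3 = 27 :> R by ring.
rewrite exprMn; apply: ler_wpM2l; last exact: cap_set_certificate rE.
by rewrite exprn_ge0 // exprn_ge0 // divr_ge0.
Qed.

Lemma cw2_rate_exprn (R : realType) :
  (1 + 2%:R * (1 / 2) + (1 / 2) ^+ 2 : R) ^+ (3 * 25) <=
  (1 / 2) ^+ (2 * 25) * 4%:R ^+ (3 * 23).
Proof.
have -> : 1 + 2%:R * (1 / 2) + (1 / 2) ^+ 2 = 9 / 4 :> R by field.
have -> : (9 / 4) ^+ (3 * 25) = (1 / 2) ^+ (2 * 25) * (9 ^+ 75 / 2 ^+ 100) :> R.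
  by rewrite !expr_div_n expr1n; field.
rewrite ler_wpM2l ?exprn_ge0 ?divr_ge0 // ler_pdivrMr ?exprn_gt0 //.
by rewrite -!natrX -!natrM ler_nat; lia.
Qed.

(** Once powers of [u] are cancelled the claim is g^36 <= 2^24 * u^9. It follows from g^4 <=
    3888/625 * u, as (3888/625)^9 <= 2^24. *)
Lemma cw_rate_exprn_ge5 (R : realType) (u : R) : 5 <= u ->
  (1 + (u - 2) * (2 / u) + (2 / u) ^+ 2) ^+ (3 * 12) <=
  (2 / u) ^+ (2 * 12) * u ^+ (3 * 11).
Proof.
move=> u5; have u0 : 0 < u by lra.
(* [y] is a bound for [g] linear in 1/u, from 4/u^2 <= 4/(5u); conversely [u] is 16 / (5 (3 -
   y)). *)
set g := 1 + _ + _; pose y := 3 - 16 / 5 / u.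
have vu : u^-1 * u = 1 by rewrite mulVf ?gt_eqF.
have v0 : 0 < u^-1 by rewrite invr_gt0.
have v5 : u^-1 <= 1 / 5 by rewrite -(ler_pM2r u0) vu; lra.
have gE : g = 3 - 4 * u^-1 + 4 * u^-1 ^+ 2 by rewrite /g; field; rewrite gt_eqF.
have g0 : 0 <= g by rewrite gE; nra.
have gy : g <= y by rewrite gE /y; nra.
have y0 : 0 <= y by exact: le_trans gy.
(* [(3 - y) y^4] is maximal at [y = 12 / 5] *)
have yle : (3 - y) * y ^+ 4 <= 3 / 5 * (12 / 5) ^+ 4.
  rewrite -subr_ge0.
  rewrite (_ : _ - _ = (y - 12 / 5) ^+ 2
      * (y ^+ 3 + 9 / 5 * y ^+ 2 + 72 / 25 * y + 432 / 125)); last by field.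
  have y2 := exprn_ge0 2 y0; have y3 := exprn_ge0 3 y0.
  by apply: mulr_ge0; [exact: sqr_ge0 | lra].
have g4 : g ^+ 4 <= 3888 / 625 * u.
  apply: (@le_trans _ _ (y ^+ 4)); first by rewrite lerXn2r ?nnegrE.
  have -> : y ^+ 4 = (3 - y) * y ^+ 4 * (5 / 16 * u).
    by rewrite /y; field; rewrite gt_eqF.
  apply: (@le_trans _ _ (3 / 5 * (12 / 5) ^+ 4 * (5 / 16 * u))); last by lra.
  by rewrite ler_wpM2r // mulr_ge0 // ltW.
rewrite (_ : (3 * 12 = 4 * 9)%N) // exprM.
apply: (@le_trans _ _ ((3888 / 625 * u) ^+ 9)).
  have k0 : 0 <= 3888 / 625 * u by lra.
  by apply: lerXn2r => //; rewrite nnegrE exprn_ge0.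
have -> : (2 / u) ^+ (2 * 12) * u ^+ (3 * 11) = 2 ^+ 24 * u ^+ 9.
  rewrite expr_div_n (_ : (3 * 11 = 2 * 12 + 9)%N) // exprD.
  by rewrite mulrA divfK // gt_eqF // exprn_gt0.
rewrite exprMn; apply: ler_wpM2r; last by lra.
by rewrite exprn_ge0 ?ltW.
Qed.

Definition omega0 (R : realType) : R := 2 + 168 / 10 ^+ 3 + 5 / 10 ^+ 5.

Lemma cw_rate (R : realType) (q : nat) : (0 < q)%N ->
  exists2 t : R, 0 < t < 1 &
    ((1 + q%:R * t + t ^+ 2) * t `^ (- (2 / 3))) `^ (omega0 R / 2) < q.+2%:R.
Proof.
have w0 : 0 < omega0 R by rewrite /omega0; lra.
have G0 (p : nat) (t : R) : 0 < t -> 0 < 1 + p%:R * t + t ^+ 2.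
  move=> t0; have t0' := ltW t0.
  by rewrite -addrA ltr_pwDl // addr_ge0 ?exprn_ge0 ?mulr_ge0 ?ler0n.
(* The best t is the positive root of 4 t^2 + q t = 2: about 16/27 for q = 1, exactly 1/2 for q = 2.
   For larger q the simpler 2/(q+2) is good enough. *)
case: q => // -[|[|q]] _.
- exists (16 / 27); first by lra.
  apply: rate_lt_of_exprn (cw1_rate_exprn R) => //;
    try (by rewrite ?ltr1n); try lra.
  by rewrite (natrD R (12 * 90)) (natrD R (13 * 90)) !natrM /omega0; lra.
- exists (1 / 2); first by lra.
  apply: rate_lt_of_exprn (cw2_rate_exprn R) => //;
    try (by rewrite ?ltr1n); try lra.
  by rewrite /omega0; lra.
- have u5 : 5 <= q.+3.+2%:R :> R by rewrite ler_nat.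
  have u0 : 0 < q.+3.+2%:R :> R by lra.
  exists (2 / q.+3.+2%:R).
    by rewrite divr_gt0 //= ltr_pdivrMr // mul1r; lra.
  have := cw_rate_exprn_ge5 u5; rewrite (_ : q.+3.+2%:R - 2 = q.+3%:R :> R);
    last by rewrite -natrB.
  apply: rate_lt_of_exprn => //; first by lra.
  by rewrite /omega0; lra.
Qed.

(** * Lower bound on the exponents obtained from [CW] *)

Lemma CW_bound (R : realType) (F : fieldType) (q n m : nat)
    (a b c : 'I_m -> nat) (t : R) :
  (forall l, [/\ (0 < a l)%N, (0 < b l)%N & (0 < c l)%N]) ->
  degeneration (tensor_pow (CW F q) n)
    (direct_sum (fun l => matmul F (a l) (b l) (c l))) ->
  0 < t < 1 ->
  \sum_l (a l * b l * c l)%N%:R `^ (2 / 3) <=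
    ((1 + q%:R * t + t ^+ 2) * t `^ (- (2 / 3))) ^+ n.
Proof.
move=> pos deg t01; have /andP[t0 _] := t01.
have := matmul_degeneration_bound
  (fun x y z nz => eq_leq (CW_pow_support nz)) pos deg t01.
rewrite !cw_weight_gen -mulr_suml.
rewrite exprMn; set G := (1 + _ + _) ^+ n.
have -> : (t `^ (- (2 / 3))) ^+ n = (t `^ ((2 * n)%:R / 3))^-1.
  rewrite -powR_mulrn ?powR_ge0 // -powRrM -powRN; congr powR.
  by rewrite natrM; field.
rewrite (_ : G + G + G = 3 * G); last by ring.
by rewrite ler_pM2l // -ler_pdivlMr // powR_gt0.
Qed.

(** If w < [omega0 R], then, as all volumes v are at least 1, sum v^(w/3) <= sum v^(omega0/3) <=
    (sum v^(2/3))^(omega0/2) <= (s^(omega0/2))^n < (q+2)^n, too small to be the power of the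
    asymptotic rank. *)
Lemma CW_universal_bound (R : realType) (F : fieldType) (q : nat) (w : R) :
  (0 < q)%N ->
  universal_bounds R (CW F q) w -> omega0 R <= w.
Proof.
move=> q0 [n [m [a [b [c [n0 pos deg eqw]]]]]].
rewrite leNgt; apply/negP => ww.
have [t t01 rate] := cw_rate R q0; have /andP[t0 _] := t01.
set s := _ * _ in rate.
have s0 : 0 <= s.
  by rewrite mulr_ge0 ?powR_ge0 // !addr_ge0 ?mulr_ge0 ?exprn_ge0 // ltW.
have := CW_bound pos deg t01; rewrite -/s => le_s.
pose v l : R := (a l * b l * c l)%N%:R.
have v1 l : 1 <= v l.
  by have [al bl cl] := pos l; rewrite ler1n !muln_gt0 al bl cl.
suff : asymptotic_rank R (CW F q) ^+ n < q.+2%:R ^+ n.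
  by rewrite ltNge lerXn2r ?nnegrE ?(le_trans _ (asymptotic_rank_CW_ge F q R)).
rewrite -eqw.
apply: (@le_lt_trans _ _ (\sum_l (v l `^ (2 / 3)) `^ (omega0 R / 2))).
  apply: ler_sum => l _; rewrite -powRrM; apply: ler_powR; first exact: v1.
  by lra.
apply: (le_lt_trans (powR_superadd _ _)).
- by rewrite /omega0; lra.
- by move=> l; exact: powR_ge0.
apply: (@le_lt_trans _ _ ((s ^+ n) `^ (omega0 R / 2))).
  rewrite ge0_ler_powR ?nnegrE ?sumr_ge0 ?exprn_ge0 //.
  + by rewrite /omega0; lra.
  + by move=> l _; exact: powR_ge0.
rewrite -powR_mulrn // powRAC powR_mulrn ?powR_ge0 //.
by rewrite ltrXn2r ?nnegrE ?powR_ge0 // -lt0n.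
Qed.

Theorem theorem1p1 (R : realType) (F : fieldType) (q : nat) (hq : (0 < q)%N) :
  ((2 + 168 / 10 ^+ 3 + 5 / 10 ^+ 5)%:E <= omega_u R (CW F q))%E.
Proof.
apply: le_ereal_inf_tmp => _ [w wb <-]; rewrite lee_fin.
exact: CW_universal_bound hq wb.
Qed.
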